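(* Let $\mathcal C$ be a (strict) braided monoidal category in which idempotents split, $H$ a Hopf algebra in $\mathcal C$ with isomorphic antipode, $B$ a bialgebra in the category of right $H$-crossed modules and $C$ a bialgebra in the category of left $H$-crossed modules such that $$\Psi_{C,B}\circ\Psi_{B,C}=(\mu^B_r\otimes\mu^C_l)\circ(\mathrm{id}_B\otimes\Psi_{H,H}\otimes\mathrm{id}_C)\circ(\nu^B_r\otimes\nu^C_l),$$ and let $Z=C\otimes H\otimes B$ be the associated bialgebra in $\mathcal C$. Let $\rho:B\otimes C\to I$ be a convolution invertible morphism in $\mathcal C$, with convolution inverse $\rho^-$, satisfying $$\rho\circ(\mu^B_r\otimes\mathrm{id}_C)=\rho\circ(\mathrm{id}_B\otimes\mu^C_l),$$ $$\rho\circ(\mathrm{id}_B\otimes\mathrm m_C)=\rho^{(2)}\circ(\Psi^{-1}_{B,B}\circ\Delta_B\otimes\mathrm{id}_{C\otimes C}),$$ $$\rho\circ(\mathrm m_B\otimes\mathrm{id}_C)=\rho^{(2)}\circ(\Psi^{\mathcal{DY}}_{B,B}\otimes\Psi^{-1}_{C,C}\circ\Delta_C),$$ and let $\hat\rho=\varepsilon_{C\otimes H}\otimes\rho\otimes\varepsilon_{H\otimes B}:Z\otimes Z\to I$. Then the multiplication $\mathrm m_Z^{\hat\rho}$ of the twisted bialgebra $Z_{\hat\rho}$ is $$\begin{aligned}\mathrm m_Z^{\hat\rho}=\;&(\mathrm m_C\otimes\mathrm m_H\otimes\mathrm m_B)\circ(\mathrm{id}_C\otimes\mu_l^C\otimes\mathrm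 m_H\otimes\mathrm{id}_H\otimes\mu_r^B\otimes\mathrm{id}_B)\\&\circ(\mathrm{id}_C\otimes\mathrm{id}_H\otimes\Psi_{H,C}\otimes\mathrm{id}_H\otimes\Psi_{B,H}\otimes\mathrm{id}_H\otimes\mathrm{id}_B)\\&\circ(\mathrm{id}_{C\otimes H\otimes H}\otimes\mu_l^C\otimes\mathrm m_H\otimes\mu_r^B\otimes\mathrm{id}_{H\otimes H\otimes B})\\&\circ(\mathrm{id}_{C\otimes H\otimes H}\otimes\mathrm{id}_H\otimes\Psi_{H,C}\otimes\Psi_{B,H}\otimes\mathrm{id}_H\otimes\mathrm{id}_{H\otimes H\otimes B})\\&\circ(\mathrm{id}_{C\otimes H\otimes H}\otimes\rho\otimes\Delta_H\otimes\mathrm{id}_C\otimes\mathrm{id}_B\otimes\Delta_H\otimes\rho^-\otimes\mathrm{id}_{H\otimes H\otimes B})\\&\circ(\mathrm{id}_{C\otimes H\otimes H}\otimes\mathrm{id}_B\otimes\Psi_{H,C}\otimes\mathrm{id}_C\otimes\mathrm{id}_B\otimes\Psi_{B,H}\otimes\mathrm{id}_C\otimes\mathrm{id}_{H\otimes H\otimes B})\\&\circ(\mathrm{id}_{C\otimes H\otimes H}\otimes\nu_r^B\otimes\Delta_C\otimes\Delta_B\otimes\nu_l^C\otimes\mathrm{id}_{H\otimes H\otimes B})\\&\circ(\mathrm{id}_{C\otimes H\otimes H}\otimes\mathrm{id}_B\otimes\Psi_{B,C}\otimes\mathrm{id}_C\otimes\mathrm{id}_{H\otimes H\otimes B})\c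irc(\mathrm{id}_C\otimes\Delta_H\otimes\Delta_B\otimes\Delta_C\otimes\Delta_H\otimes\mathrm{id}_B).\end{aligned}$$
   Context: $\Psi$ is the braiding of $\mathcal C$, $I$ its unit object. $\varepsilon_{C\otimes H}=\varepsilon_C\otimes\varepsilon_H$, $\varepsilon_{H\otimes B}=\varepsilon_H\otimes\varepsilon_B$, $\rho^{(2)}=\rho\circ(\mathrm{id}_B\otimes\rho\otimes\mathrm{id}_C):B\otimes B\otimes C\otimes C\to I$. Crossed modules. A right $H$-crossed module is an object $M$ with right $H$-action $\mu_r$ and right $H$-coaction $\nu_r$ such that $(\mu_r\otimes\mathrm m_H)(\mathrm{id}_M\otimes\Psi_{H,H}\otimes\mathrm{id}_H)(\nu_r\otimes\Delta_H)=(\mathrm{id}_M\otimes\mathrm m_H)(\Psi_{H,M}\otimes\mathrm{id}_H)(\mathrm{id}_H\otimes\nu_r\mu_r)(\Psi_{M,H}\otimes\mathrm{id}_H)(\mathrm{id}_M\otimes\Delta_H)$; these form a monoidal category with diagonal (co)actions, braided by $\Psi^{\mathcal{DY}}_{M,N}=(\mathrm{id}_N\otimes\mu_r^M)(\Psi_{M,N}\otimes\mathrm{id}_H)(\mathrm{id}_M\otimes\nu_r^N):M\otimes N\to N\otimes M$. Left $H$-crossed modules are the mirror notion, braided by $(\mu_l^N\otimes\mathrm{id}_M)(\mathrm{id}_H\otimes\Psi_{M,N})(\nu_l^M\otimes\mathrm{id}_N)$. $\mu_r^B,\nu_r^B$ and $\mu_l^C,\nu_l^C$ denote the crossed module structures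 of $B$ and $C$. The bialgebra $Z=C\otimes H\otimes B$ (obtained from the tensor product of the Hopf bimodule bialgebras $C\rtimes H$ and $H\ltimes B$) has unit $\eta_C\otimes\eta_H\otimes\eta_B$, counit $\varepsilon_C\otimes\varepsilon_H\otimes\varepsilon_B$ and $$\mathrm m_Z=(\mathrm m_C\otimes\mathrm{id}_H\otimes\mathrm m_B)(\mathrm{id}_C\otimes\mu_l^C\otimes\mathrm m_H\otimes\mu_r^B\otimes\mathrm{id}_B)(\mathrm{id}_C\otimes\mathrm{id}_H\otimes\Psi_{H,C}\otimes\Psi_{B,H}\otimes\mathrm{id}_H\otimes\mathrm{id}_B)(\mathrm{id}_C\otimes\Delta_H\otimes\Psi_{B,C}\otimes\Delta_H\otimes\mathrm{id}_B),$$ $$\Delta_Z=(\mathrm{id}_C\otimes\mathrm m_H\otimes\Psi_{C,B}\otimes\mathrm m_H\otimes\mathrm{id}_B)(\mathrm{id}_C\otimes\mathrm{id}_H\otimes\Psi_{C,H}\otimes\Psi_{H,B}\otimes\mathrm{id}_H\otimes\mathrm{id}_B)(\mathrm{id}_C\otimes\nu_l^C\otimes\Delta_H\otimes\nu_r^B\otimes\mathrm{id}_B)(\Delta_C\otimes\mathrm{id}_H\otimes\Delta_B).$$ Convolution and twist. For coalgebras $D,E$ in $\mathcal C$, $D\otimes E$ is the coalgebra with $\Delta_{D\otimes E}=(\mathrm{id}\otimes\Psi_{D,E}\otimes\mathrm{id})(\Delta_D\otimes\Delta_E)$; convolution of morphisms to $I$ is $(\chi\otimes\chi')\circ\Delta$.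 For $\chi:D\to I$, $f:D\to F$ put $\chi.f=(\chi\otimes f)\circ\Delta_D$, $f.\chi=(f\otimes\chi)\circ\Delta_D$. A 2-cocycle of a bialgebra $Z$ is $\chi:Z\otimes Z\to I$ with $\chi\circ(\mathrm{id}_Z\otimes\chi.\mathrm m)=\chi\circ(\chi.\mathrm m\otimes\mathrm{id}_Z)$ and $\chi\circ(\eta\otimes\mathrm{id}_Z)=\varepsilon=\chi\circ(\mathrm{id}_Z\otimes\eta)$. For a convolution invertible 2-cocycle $\chi$, the twisted bialgebra $Z_\chi$ has the same $\eta,\Delta,\varepsilon$ and multiplication $\mathrm m_Z^\chi=\chi.\mathrm m_Z.\chi^-$, formed with respect to the coalgebra $Z\otimes Z$. Under the hypotheses of the claim, $\hat\rho$ is a convolution invertible 2-cocycle of $Z$ with inverse $\varepsilon_{C\otimes H}\otimes\rho^-\otimes\varepsilon_{H\otimes B}$. *)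

(* Defs.v *)
From mathcomp Require Import ssreflect ssrfun ssrbool.

Set Implicit Arguments.
Unset Strict Implicit.
Unset Printing Implicit Defensive.

Declare Scope cat_scope.
Delimit Scope cat_scope with C.
Local Open Scope cat_scope.

(* In a strict monoidal category the associativity and unit laws of the tensor
   product are equalities of objects.  To state them without transporting
   morphisms along such equalities, a strict monoidal category is presented as
   a category object in monoids: one type of objects, one type of all
   morphisms, source and target maps, and the tensor product as a monoid
   operation on each of the two types.  A morphism f : X -> Y is an
   f with dom f = X and cod f = Y.

   [comp g f] is g after f.  It is a total operation, but its value is
   specified only when dom g = cod f. *)
Record strictBraidedCat := StrictBraidedCat {
  ob : Type;
  mor : Type;
  dom : mor -> ob;
  cod : mor -> ob;
  idm : ob -> mor;
  comp : mor -> mor -> mor;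
  ounit : ob;
  otens : ob -> ob -> ob;
  mtens : mor -> mor -> mor;
  braid : ob -> ob -> mor;
  braidV : ob -> ob -> mor;

  dom_idm : forall X, dom (idm X) = X;
  cod_idm : forall X, cod (idm X) = X;
  dom_comp : forall g f, dom g = cod f -> dom (comp g f) = dom f;
  cod_comp : forall g f, dom g = cod f -> cod (comp g f) = cod g;
  comp_idl : forall f, comp (idm (cod f)) f = f;
  comp_idr : forall f, comp f (idm (dom f)) = f;
  compA : forall h g f, dom h = cod g -> dom g = cod f ->
    comp h (comp g f) = comp (comp h g) f;

  otensA : associative otens;
  otens1X : left_id ounit otens;
  otensX1 : right_id ounit otens;
  dom_mtens : forall f g, dom (mtens f g) = otens (dom f) (dom g);
  cod_mtens : forall f g, cod (mtens f g) = otens (cod f) (cod g);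
  mtensA : associative mtens;
  mtens1f : left_id (idm ounit) mtens;
  mtensf1 : right_id (idm ounit) mtens;
  mtens_idm : forall X Y, mtens (idm X) (idm Y) = idm (otens X Y);
  mtens_comp : forall g f g' f', dom g = cod f -> dom g' = cod f' ->
    mtens (comp g f) (comp g' f') = comp (mtens g g') (mtens f f');

  dom_braid : forall X Y, dom (braid X Y) = otens X Y;
  cod_braid : forall X Y, cod (braid X Y) = otens Y X;
  dom_braidV : forall X Y, dom (braidV X Y) = otens Y X;
  cod_braidV : forall X Y, cod (braidV X Y) = otens X Y;
  braidK : forall X Y, comp (braidV X Y) (braid X Y) = idm (otens X Y);
  braidVK : forall X Y, comp (braid X Y) (braidV X Y) = idm (otens Y X);
  braid_nat : forall f g,
    comp (braid (cod f) (cod g)) (mtens f g) =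
    comp (mtens g f) (braid (dom f) (dom g));
  braid_tensr : forall X Y Z, braid X (otens Y Z) =
    comp (mtens (idm Y) (braid X Z)) (mtens (braid X Y) (idm Z));
  braid_tensl : forall X Y Z, braid (otens X Y) Z =
    comp (mtens (braid X Z) (idm Y)) (mtens (idm X) (braid Y Z))
}.

Notation "X ⊠ Y" := (otens X Y) (at level 40, left associativity) : cat_scope.
Notation "f ⊗ g" := (mtens f g) (at level 40, left associativity) : cat_scope.
Notation "g ∘ f" := (comp g f) (at level 50, left associativity) : cat_scope.
Notation "\I" := (ounit _) (at level 0) : cat_scope.
Notation "\id_ X" := (idm X)
  (at level 8, X at level 2, format "\id_ X") : cat_scope.
Notation "\Psi_( X , Y )" := (braid X Y)
  (at level 8, format "\Psi_( X ,  Y )") : cat_scope.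
(* The inverse of \Psi_(X, Y), a morphism from Y ⊠ X to X ⊠ Y. *)
Notation "\PsiV_( X , Y )" := (braidV X Y)
  (at level 8, format "\PsiV_( X ,  Y )") : cat_scope.

Definition is_hom (K : strictBraidedCat) (f : mor K) (X Y : ob K) : Prop :=
  dom f = X /\ cod f = Y.
Notation "f ∷ X ⟶ Y" := (is_hom f X Y)
  (at level 70, X at level 60, Y at level 60) : cat_scope.

Definition idempotents_split (K : strictBraidedCat) : Prop :=
  forall (X : ob K) (e : mor K), e ∷ X ⟶ X -> e ∘ e = e ->
  exists (Y : ob K) (p i : mor K),
    [/\ p ∷ X ⟶ Y, i ∷ Y ⟶ X, i ∘ p = e & p ∘ i = \id_Y].

Definition is_iso (K : strictBraidedCat) (f : mor K) : Prop :=
  exists g : mor K, [/\ g ∷ cod f ⟶ dom f, g ∘ f = \id_(dom f)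
                      & f ∘ g = \id_(cod f)].

(* Bare data; the axioms are the predicates below. *)
Record coalgData (K : strictBraidedCat) := CoalgData {
  cobj :> ob K; comul : mor K; counit : mor K }.

Record bialgData (K : strictBraidedCat) := BialgData {
  bcoalg :> coalgData K; bmul : mor K; bone : mor K }.

Notation "\Delta_ D" := (@comul _ D)
  (at level 8, D at level 2, format "\Delta_ D") : cat_scope.
Notation "\eps_ D" := (@counit _ D)
  (at level 8, D at level 2, format "\eps_ D") : cat_scope.
Notation "\m_ A" := (@bmul _ A)
  (at level 8, A at level 2, format "\m_ A") : cat_scope.
Notation "\eta_ A" := (@bone _ A)
  (at level 8, A at level 2, format "\eta_ A") : cat_scope.

Section Bialgebras.
Variable K : strictBraidedCat.
Implicit Types (D E : coalgData K) (A H Z : bialgData K).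
Implicit Types (f g chi psi : mor K).

Definition is_coalgebra D : Prop :=
  [/\ \Delta_D ∷ D ⟶ D ⊠ D, \eps_D ∷ D ⟶ \I,
      (\Delta_D ⊗ \id_D) ∘ \Delta_D = (\id_D ⊗ \Delta_D) ∘ \Delta_D,
      (\eps_D ⊗ \id_D) ∘ \Delta_D = \id_D
    & (\id_D ⊗ \eps_D) ∘ \Delta_D = \id_D].

Definition is_algebra A : Prop :=
  [/\ \m_A ∷ A ⊠ A ⟶ A, \eta_A ∷ \I ⟶ A,
      \m_A ∘ (\m_A ⊗ \id_A) = \m_A ∘ (\id_A ⊗ \m_A),
      \m_A ∘ (\eta_A ⊗ \id_A) = \id_A
    & \m_A ∘ (\id_A ⊗ \eta_A) = \id_A].

(* Bialgebra axioms with respect to a braiding psi of A with itself: the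
   ambient one for a bialgebra in K, the one of crossed modules for a bialgebra
   in a category of crossed modules. *)
Definition is_bialgebra psi A : Prop :=
  [/\ is_algebra A, is_coalgebra A &
  [/\ \Delta_A ∘ \m_A =
        (\m_A ⊗ \m_A) ∘ (\id_A ⊗ psi ⊗ \id_A) ∘ (\Delta_A ⊗ \Delta_A),
      \Delta_A ∘ \eta_A = \eta_A ⊗ \eta_A,
      \eps_A ∘ \m_A = \eps_A ⊗ \eps_A
    & \eps_A ∘ \eta_A = \id_(ounit K)]].

Definition is_hopf_algebra H (S : mor K) : Prop :=
  [/\ is_bialgebra \Psi_(H, H) H, S ∷ H ⟶ H,
      \m_H ∘ (S ⊗ \id_H) ∘ \Delta_H = \eta_H ∘ \eps_H
    & \m_H ∘ (\id_H ⊗ S) ∘ \Delta_H = \eta_H ∘ \eps_H].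

Definition tens_coalg D E : coalgData K :=
  CoalgData (D ⊠ E)
    ((\id_D ⊗ \Psi_(D, E) ⊗ \id_E) ∘ (\Delta_D ⊗ \Delta_E))
    (\eps_D ⊗ \eps_E).

(* Convolution f.g; when one of f, g has target \I this is the action of
   functionals on morphisms, and when both have it is their convolution
   product. *)
Definition conv D f g : mor K := (f ⊗ g) ∘ \Delta_D.

Definition is_conv_inverse D chi chiV : Prop :=
  [/\ chi ∷ D ⟶ \I, chiV ∷ D ⟶ \I,
      conv D chi chiV = \eps_D & conv D chiV chi = \eps_D].

(* Z twisted by chi, whose convolution inverse is chiV: the multiplication
   becomes chi.m.chiV. *)
Definition twist Z chi chiV : bialgData K :=
  let ZZ := tens_coalg Z Z in
  BialgData Z (conv ZZ (conv ZZ chi \m_Z) chiV) \eta_Z.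

End Bialgebras.

(* An object with an action and a coaction of H; the side is fixed by the
   predicates below. *)
Record crossedData (K : strictBraidedCat) := CrossedData {
  xobj :> ob K; act : mor K; coact : mor K }.

Section RightCrossedModules.
Variables (K : strictBraidedCat) (H : bialgData K).
Implicit Types (M N : crossedData K) (f : mor K).

Definition is_right_module M : Prop :=
  [/\ act M ∷ M ⊠ H ⟶ M,
      act M ∘ (act M ⊗ \id_H) = act M ∘ (\id_M ⊗ \m_H)
    & act M ∘ (\id_M ⊗ \eta_H) = \id_M].

Definition is_right_comodule M : Prop :=
  [/\ coact M ∷ M ⟶ M ⊠ H,
      (coact M ⊗ \id_H) ∘ coact M = (\id_M ⊗ \Delta_H) ∘ coact M
    & (\id_M ⊗ \eps_H) ∘ coact M = \id_M].

Definition is_right_crossed_module M : Prop :=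
  [/\ is_right_module M, is_right_comodule M &
      (act M ⊗ \m_H) ∘ (\id_M ⊗ \Psi_(H, H) ⊗ \id_H) ∘ (coact M ⊗ \Delta_H)
      = (\id_M ⊗ \m_H) ∘ (\Psi_(H, M) ⊗ \id_H) ∘ (\id_H ⊗ (coact M ∘ act M))
          ∘ (\Psi_(M, H) ⊗ \id_H) ∘ (\id_M ⊗ \Delta_H)].

Definition right_crossed_map f M N : Prop :=
  [/\ f ∷ M ⟶ N, f ∘ act M = act N ∘ (f ⊗ \id_H)
    & coact N ∘ f = (f ⊗ \id_H) ∘ coact M].

Definition right_crossed_unit : crossedData K :=
  CrossedData (ounit K) \eps_H \eta_H.

Definition right_crossed_tens M N : crossedData K :=
  CrossedData (M ⊠ N)
    ((act M ⊗ act N) ∘ (\id_M ⊗ \Psi_(N, H) ⊗ \id_H)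
       ∘ (\id_M ⊗ \id_N ⊗ \Delta_H))
    ((\id_M ⊗ \id_N ⊗ \m_H) ∘ (\id_M ⊗ \Psi_(H, N) ⊗ \id_H)
       ∘ (coact M ⊗ coact N)).

Definition right_crossed_braid M N : mor K :=
  (\id_N ⊗ act M) ∘ (\Psi_(M, N) ⊗ \id_H) ∘ (\id_M ⊗ coact N).

(* B, with action mu and coaction nu, is a bialgebra in the braided monoidal
   category of right H-crossed modules. *)
Definition is_right_crossed_bialgebra (B : bialgData K) (mu nu : mor K) : Prop :=
  let M := CrossedData B mu nu in
  let MM := right_crossed_tens M M in
  [/\ is_right_crossed_module M,
      [/\ right_crossed_map \m_B MM M,
          right_crossed_map \eta_B right_crossed_unit M,
          right_crossed_map \Delta_B M MM
        & right_crossed_map \eps_B M right_crossed_unit]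
    & is_bialgebra (right_crossed_braid M M) B].

End RightCrossedModules.

(* Mirror image of the right-handed notions: the order of tensor factors is
   reversed, and every \Psi_(X, Y) becomes \Psi_(Y, X) (not an inverse
   braiding). *)
Section LeftCrossedModules.
Variables (K : strictBraidedCat) (H : bialgData K).
Implicit Types (M N : crossedData K) (f : mor K).

Definition is_left_module M : Prop :=
  [/\ act M ∷ H ⊠ M ⟶ M,
      act M ∘ (\id_H ⊗ act M) = act M ∘ (\m_H ⊗ \id_M)
    & act M ∘ (\eta_H ⊗ \id_M) = \id_M].

Definition is_left_comodule M : Prop :=
  [/\ coact M ∷ M ⟶ H ⊠ M,
      (\id_H ⊗ coact M) ∘ coact M = (\Delta_H ⊗ \id_M) ∘ coact M
    & (\eps_H ⊗ \id_M) ∘ coact M = \id_M].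

Definition is_left_crossed_module M : Prop :=
  [/\ is_left_module M, is_left_comodule M &
      (\m_H ⊗ act M) ∘ (\id_H ⊗ \Psi_(H, H) ⊗ \id_M) ∘ (\Delta_H ⊗ coact M)
      = (\m_H ⊗ \id_M) ∘ (\id_H ⊗ \Psi_(M, H)) ∘ ((coact M ∘ act M) ⊗ \id_H)
          ∘ (\id_H ⊗ \Psi_(H, M)) ∘ (\Delta_H ⊗ \id_M)].

Definition left_crossed_map f M N : Prop :=
  [/\ f ∷ M ⟶ N, f ∘ act M = act N ∘ (\id_H ⊗ f)
    & coact N ∘ f = (\id_H ⊗ f) ∘ coact M].

Definition left_crossed_unit : crossedData K :=
  CrossedData (ounit K) \eps_H \eta_H.

Definition left_crossed_tens M N : crossedData K :=
  CrossedData (M ⊠ N)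
    ((act M ⊗ act N) ∘ (\id_H ⊗ \Psi_(H, M) ⊗ \id_N)
       ∘ (\Delta_H ⊗ \id_M ⊗ \id_N))
    ((\m_H ⊗ \id_M ⊗ \id_N) ∘ (\id_H ⊗ \Psi_(M, H) ⊗ \id_N)
       ∘ (coact M ⊗ coact N)).

Definition left_crossed_braid M N : mor K :=
  (act N ⊗ \id_M) ∘ (\id_H ⊗ \Psi_(M, N)) ∘ (coact M ⊗ \id_N).

Definition is_left_crossed_bialgebra (C : bialgData K) (mu nu : mor K) : Prop :=
  let M := CrossedData C mu nu in
  let MM := left_crossed_tens M M in
  [/\ is_left_crossed_module M,
      [/\ left_crossed_map \m_C MM M,
          left_crossed_map \eta_C left_crossed_unit M,
          left_crossed_map \Delta_C M MM
        & left_crossed_map \eps_C M left_crossed_unit]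
    & is_bialgebra (left_crossed_braid M M) C].

End LeftCrossedModules.

(* The bialgebra Z = C ⊗ H ⊗ B, where muC, nuC are the left action and
   coaction of H on C and muB, nuB the right ones on B. *)
Definition cross_bialg (K : strictBraidedCat) (H : bialgData K)
    (C : bialgData K) (muC nuC : mor K)
    (B : bialgData K) (muB nuB : mor K) : bialgData K :=
  BialgData
    (CoalgData (C ⊠ H ⊠ B)
       ((\id_C ⊗ \m_H ⊗ \Psi_(C, B) ⊗ \m_H ⊗ \id_B)
        ∘ (\id_C ⊗ \id_H ⊗ \Psi_(C, H) ⊗ \Psi_(H, B) ⊗ \id_H ⊗ \id_B)
        ∘ (\id_C ⊗ nuC ⊗ \Delta_H ⊗ nuB ⊗ \id_B)
        ∘ (\Delta_C ⊗ \id_H ⊗ \Delta_B))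
       (\eps_C ⊗ \eps_H ⊗ \eps_B))
    ((\m_C ⊗ \id_H ⊗ \m_B)
     ∘ (\id_C ⊗ muC ⊗ \m_H ⊗ muB ⊗ \id_B)
     ∘ (\id_C ⊗ \id_H ⊗ \Psi_(H, C) ⊗ \Psi_(B, H) ⊗ \id_H ⊗ \id_B)
     ∘ (\id_C ⊗ \Delta_H ⊗ \Psi_(B, C) ⊗ \Delta_H ⊗ \id_B))
    (\eta_C ⊗ \eta_H ⊗ \eta_B).

(* \hat\rho; it is applied to rho and to its convolution inverse. *)
Definition hat (K : strictBraidedCat) (C H B : bialgData K) (rho : mor K) :
    mor K :=
  (\eps_C ⊗ \eps_H) ⊗ rho ⊗ (\eps_H ⊗ \eps_B).

Definition pairing2 (K : strictBraidedCat) (B C : bialgData K) (rho : mor K) :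
    mor K :=
  rho ∘ (\id_B ⊗ rho ⊗ \id_C).

(* Main.v *)
Require Import Defs.
From mathcomp Require Import ssreflect ssrfun ssrbool eqtype ssrnat seq.

Set Implicit Arguments.
Unset Strict Implicit.
Unset Printing Implicit Defensive.
Local Open Scope cat_scope.

(* The twisted multiplication is m_Z after the two morphisms
   (rho-hat ⊗ id) Delta_(Z ⊗ Z) and (id ⊗ rho-hat^-) Delta_(Z ⊗ Z).  The
   counits in rho-hat remove almost all of Delta_Z: on z = c ⊗ h ⊗ b and
   z' = c' ⊗ h' ⊗ b' the first one only applies rho to c'_(1) and the B-part of
   nu(b_(1)), and multiplies the H-part of nu(b_(1)) into h; the second one is
   symmetric.  It remains to multiply out with m_Z, using that Delta_H is
   multiplicative, that mu_r^B and mu_l^C are actions, and that Delta_B is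
   coassociative; strands are exchanged by naturality of the braiding. *)

(** * Strict braided categories *)

Section StrictBraided.
Variable K : strictBraidedCat.
Implicit Types (X Y Z : ob K) (f g h k : mor K).

Lemma hom_idm X : \id_X ∷ X ⟶ X.
Proof. by split; rewrite ?dom_idm ?cod_idm. Qed.

Lemma hom_comp X Y Z g f : f ∷ X ⟶ Y -> g ∷ Y ⟶ Z -> g ∘ f ∷ X ⟶ Z.
Proof.
by move=> [<- cf] [dg <-]; split; rewrite ?dom_comp ?cod_comp // cf dg.
Qed.

Lemma hom_tens X Y X' Y' f g :
  f ∷ X ⟶ Y -> g ∷ X' ⟶ Y' -> f ⊗ g ∷ X ⊠ X' ⟶ Y ⊠ Y'.
Proof. by move=> [<- <-] [<- <-]; split; rewrite ?dom_mtens ?cod_mtens. Qed.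

Lemma hom_braid X Y : \Psi_(X, Y) ∷ X ⊠ Y ⟶ Y ⊠ X.
Proof. by split; rewrite ?dom_braid ?cod_braid. Qed.

Lemma comp_homl X Y f : f ∷ X ⟶ Y -> \id_Y ∘ f = f.
Proof. by move=> [_ <-]; apply: comp_idl. Qed.

Lemma comp_homr X Y f : f ∷ X ⟶ Y -> f ∘ \id_X = f.
Proof. by move=> [<- _]; apply: comp_idr. Qed.

Lemma comp_homA X Y Z T f g h : f ∷ X ⟶ Y -> g ∷ Y ⟶ Z -> h ∷ Z ⟶ T ->
  h ∘ (g ∘ f) = h ∘ g ∘ f.
Proof. by move=> [_ cf] [dg cg] [dh _]; apply: Defs.compA; congruence. Qed.

Lemma tens_hom_comp X Y Z X' Y' Z' f g f' g' :
  f ∷ X ⟶ Y -> g ∷ Y ⟶ Z -> f' ∷ X' ⟶ Y' -> g' ∷ Y' ⟶ Z' ->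
  (g ∘ f) ⊗ (g' ∘ f') = (g ⊗ g') ∘ (f ⊗ f').
Proof.
by move=> [_ cf] [dg _] [_ cf'] [dg' _]; apply: mtens_comp; congruence.
Qed.

Lemma tens_interchange X Y X' Y' f g : f ∷ X ⟶ Y -> g ∷ X' ⟶ Y' ->
  (\id_Y ⊗ g) ∘ (f ⊗ \id_X') = (f ⊗ \id_Y') ∘ (\id_X ⊗ g).
Proof.
move=> hf hg; have hid := hom_idm.
rewrite -(tens_hom_comp hf (hid Y) (hid X') hg).
rewrite -(tens_hom_comp (hid X) hf hg (hid Y')).
by rewrite (comp_homl hf) (comp_homr hf) (comp_homl hg) (comp_homr hg).
Qed.

Lemma tens_id_comp X Y Z W f g : f ∷ X ⟶ Y -> g ∷ Y ⟶ Z ->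
  \id_W ⊗ (g ∘ f) = (\id_W ⊗ g) ∘ (\id_W ⊗ f).
Proof.
move=> hf hg; have hW := hom_idm W.
by rewrite -(tens_hom_comp hW hW hf hg) (comp_homl hW).
Qed.

Lemma tens_comp_id X Y Z W f g : f ∷ X ⟶ Y -> g ∷ Y ⟶ Z ->
  (g ∘ f) ⊗ \id_W = (g ⊗ \id_W) ∘ (f ⊗ \id_W).
Proof.
move=> hf hg; have hW := hom_idm W.
by rewrite -(tens_hom_comp hf hg hW hW) (comp_homl hW).
Qed.

Lemma tens_sep X Y X' Y' f g : f ∷ X ⟶ Y -> g ∷ X' ⟶ Y' ->
  f ⊗ g = (\id_Y ⊗ g) ∘ (f ⊗ \id_X').
Proof.
move=> hf hg; rewrite -(tens_hom_comp hf (hom_idm Y) (hom_idm X') hg).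
by rewrite (comp_homl hf) (comp_homr hg).
Qed.

(* An invertible idempotent is an identity; the hexagon makes the braiding
   with the unit object idempotent. *)
Lemma braid_unitr X : \Psi_(X, ounit K) = \id_X.
Proof.
have h := hom_braid X (ounit K); rewrite otensX1 otens1X in h.
have hV : \PsiV_(X, ounit K) ∷ X ⟶ X.
  by split; rewrite ?dom_braidV ?cod_braidV ?otensX1 ?otens1X.
have := braid_tensr X (ounit K) (ounit K).
rewrite otensX1 mtens1f mtensf1 => e.
have := congr1 (Defs.comp \PsiV_(X, ounit K)) e.
by rewrite (comp_homA h h hV) braidK otensX1 (comp_homl h).
Qed.

Lemma braid_unitl X : \Psi_(ounit K, X) = \id_X.
Proof.
have h := hom_braid (ounit K) X; rewrite otensX1 otens1X in h.
have hV : \PsiV_(ounit K, X) ∷ X ⟶ X.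
  by split; rewrite ?dom_braidV ?cod_braidV ?otensX1 ?otens1X.
have := braid_tensl (ounit K) (ounit K) X.
rewrite otensX1 mtens1f mtensf1 => e.
have := congr1 (Defs.comp \PsiV_(ounit K, X)) e.
by rewrite (comp_homA h h hV) braidK otens1X (comp_homl h).
Qed.

Lemma braid_natl X Y W f : f ∷ X ⟶ Y ->
  \Psi_(Y, W) ∘ (f ⊗ \id_W) = (\id_W ⊗ f) ∘ \Psi_(X, W).
Proof.
by move=> [<- <-]; have := braid_nat f \id_W; rewrite dom_idm cod_idm.
Qed.

Lemma braid_natr X Y W f : f ∷ X ⟶ Y ->
  \Psi_(W, Y) ∘ (\id_W ⊗ f) = (f ⊗ \id_W) ∘ \Psi_(W, X).
Proof.
by move=> [<- <-]; have := braid_nat \id_W f; rewrite dom_idm cod_idm.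
Qed.

End StrictBraided.

(** * Rewriting of string diagrams *)

Section Diagrams.
Variable K : strictBraidedCat.

(* A box is a morphism with its source and target, which are words in the
   atomic objects [obs]. *)
Variables (obs : seq (ob K)) (boxes : seq (mor K * (seq nat * seq nat))).

Definition atom (a : nat) : ob K := nth (ounit K) obs a.

Fixpoint wsem (w : seq nat) : ob K :=
  if w is a :: w' then atom a ⊠ wsem w' else ounit K.

(** The default entry is the identity of the unit object, which is well typed; [boxes_typed] can
    therefore quantify over all [n]. *)
Definition box n := nth (\id_(ounit K), ([::], [::])) boxes n.

(** Only crossings of two atoms are generators; crossings of longer words are composed from them by
    the hexagons. *)
Definition gen := (nat + nat * nat)%type.

Definition gdom (g : gen) : seq nat :=
  match g with inl n => (box n).2.1 | inr (a, b) => [:: a; b] end.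
Definition gcod (g : gen) : seq nat :=
  match g with inl n => (box n).2.2 | inr (a, b) => [:: b; a] end.
Definition gsem (g : gen) : mor K :=
  match g with inl n => (box n).1 | inr (a, b) => \Psi_(atom a, atom b) end.

Definition boxes_typed :=
  forall n, (box n).1 ∷ wsem (box n).2.1 ⟶ wsem (box n).2.2.

Hypothesis boxesP : boxes_typed.

Lemma wsem_cat u v : wsem (u ++ v) = wsem u ⊠ wsem v.
Proof. by elim: u => [|a u IH] /=; rewrite ?otens1X // IH otensA. Qed.

Lemma gsem_hom g : gsem g ∷ wsem (gdom g) ⟶ wsem (gcod g).
Proof.
case: g => [n|[a b]] /=; first exact: boxesP.
by rewrite !otensX1; apply: hom_braid.
Qed.

(* A diagram is a list of slices, read from its source to its target; [(n, g)]
   applies [g] with [n] wires on its left. *)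
Definition slice := (nat * gen)%type.

Definition step (w : seq nat) (s : slice) : seq nat :=
  take s.1 w ++ gcod s.2 ++ drop (s.1 + size (gdom s.2)) w.

Definition fits (w : seq nat) (s : slice) : bool :=
  (s.1 <= size w) && (take (size (gdom s.2)) (drop s.1 w) == gdom s.2).

Definition slice_sem (w : seq nat) (s : slice) : mor K :=
  \id_(wsem (take s.1 w)) ⊗ gsem s.2
    ⊗ \id_(wsem (drop (s.1 + size (gdom s.2)) w)).

Fixpoint typed w (D : seq slice) : bool :=
  if D is s :: D' then fits w s && typed (step w s) D' else true.
Fixpoint out w (D : seq slice) : seq nat :=
  if D is s :: D' then out (step w s) D' else w.
Fixpoint ev w (D : seq slice) : mor K :=
  if D is s :: D' then ev (step w s) D' ∘ slice_sem w s else \id_(wsem w).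

(** Replaces arithmetic on positions by a decomposition of the word, the form in which whiskering
    and interchange are proved. *)
Lemma fitsP w s : fits w s -> exists l r,
  w = l ++ gdom s.2 ++ r /\ s.1 = size l.
Proof.
case: s => n g /andP[/= le_n /eqP e].
exists (take n w), (drop (n + size (gdom g)) w); rewrite size_takel //.
split=> //; rewrite -{1}e addnC -drop_drop cat_take_drop.
by rewrite cat_take_drop.
Qed.

Lemma fits_cat l g r : fits (l ++ gdom g ++ r) (size l, g).
Proof.
by rewrite /fits /= size_cat leq_addr drop_size_cat // take_size_cat ?eqxx.
Qed.

Lemma step_cat l g r : step (l ++ gdom g ++ r) (size l, g) = l ++ gcod g ++ r.
Proof.
rewrite /step /= take_size_cat // addnC -drop_drop drop_size_cat //.
by rewrite drop_size_cat.
Qed.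

Lemma slice_sem_cat l g r : slice_sem (l ++ gdom g ++ r) (size l, g) =
  \id_(wsem l) ⊗ gsem g ⊗ \id_(wsem r).
Proof.
rewrite /slice_sem /= take_size_cat // addnC -drop_drop drop_size_cat //.
by rewrite drop_size_cat.
Qed.

Lemma slice_sem_hom w s : fits w s ->
  slice_sem w s ∷ wsem w ⟶ wsem (step w s).
Proof.
case: s => n g /fitsP[l [r /= [-> ->]]]; rewrite slice_sem_cat step_cat.
rewrite !wsem_cat !otensA; apply: hom_tens; last exact: hom_idm.
by apply: hom_tens; [apply: hom_idm | apply: gsem_hom].
Qed.

Lemma ev_hom w D : typed w D -> ev w D ∷ wsem w ⟶ wsem (out w D).
Proof.
elim: D w => [|s D IH] w /=; first by move=> _; apply: hom_idm.
by case/andP=> hs /IH hD; apply: hom_comp (slice_sem_hom hs) hD.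
Qed.

Lemma typed_cat w D E : typed w (D ++ E) = typed w D && typed (out w D) E.
Proof. by elim: D w => //= s D IH w; rewrite IH andbA. Qed.

Lemma out_cat w D E : out w (D ++ E) = out (out w D) E.
Proof. by elim: D w => //= s D IH w; rewrite IH. Qed.

Lemma ev_cat w D E : typed w (D ++ E) ->
  ev w (D ++ E) = ev (out w D) E ∘ ev w D.
Proof.
elim: D w => [|s D IH] w /=; first by move=> /ev_hom h; rewrite (comp_homr h).
case/andP=> hs hDE; rewrite IH //; move: hDE; rewrite typed_cat => /andP[hD hE].
by rewrite (comp_homA (slice_sem_hom hs) (ev_hom hD) (ev_hom hE)).
Qed.

Definition shift n (D : seq slice) : seq slice :=
  [seq (n + s.1, s.2) | s <- D].

(** Tensoring with identities is functorial, so an equation between diagrams can be used inside a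
    larger one. *)
Lemma whisker l w r D : typed w D ->
  [/\ typed (l ++ w ++ r) (shift (size l) D),
      out (l ++ w ++ r) (shift (size l) D) = l ++ out w D ++ r
    & ev (l ++ w ++ r) (shift (size l) D) =
        \id_(wsem l) ⊗ ev w D ⊗ \id_(wsem r)].
Proof.
elim: D w => [|[n g] D IH] w /=.
  by rewrite !mtens_idm -!wsem_cat catA.
case/andP=> hs hD; case/fitsP: (hs) => [l' [r' /= [ew en]]].
have sE : step (l ++ w ++ r) (size l + n, g) = l ++ step w (n, g) ++ r.
  rewrite ew en step_cat -!catA -size_cat (catA l) step_cat.
  by rewrite -!catA.
have fE : fits (l ++ w ++ r) (size l + n, g).
  by rewrite ew en -!catA -size_cat (catA l) fits_cat.
have eE : slice_sem (l ++ w ++ r) (size l + n, g) =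
    \id_(wsem l) ⊗ slice_sem w (n, g) ⊗ \id_(wsem r).
  rewrite ew en -!catA -size_cat (catA l) slice_sem_cat slice_sem_cat.
  by rewrite !wsem_cat -!mtens_idm !mtensA.
have [h1 h2 h3] := IH _ hD; split.
- by rewrite sE fE h1.
- by rewrite sE h2.
- rewrite sE h3 eE; have hsl := slice_sem_hom hs; have hev := ev_hom hD.
  rewrite (tens_id_comp _ hsl hev); symmetry; apply: tens_comp_id.
    exact: hom_tens (hom_idm _) hsl.
  exact: hom_tens (hom_idm _) hev.
Qed.

(** Typing is a premise here, so the moves below never check it: it is established once for the
    initial diagram and then carried along. *)
Definition refines w (D E : seq slice) : Prop := typed w D ->
  [/\ typed w E, out w E = out w D & ev w E = ev w D].

Lemma refines_trans w D E F : refines w D E -> refines w E F -> refines w D F.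
Proof. by move=> DE EF /DE[/EF[tF oF eF] oE eE]; split; congruence. Qed.

Lemma refines_cat w P D E Q : refines (out w P) D E ->
  refines w (P ++ D ++ Q) (P ++ E ++ Q).
Proof.
move=> DE t.
have /and3P[tP /DE[tE oE eE] tQ] :
    [&& typed w P, typed (out w P) D & typed (out (out w P) D) Q].
  by move: t; rewrite !typed_cat.
have t' : typed w (P ++ E ++ Q) by rewrite !typed_cat tP tE oE.
split; [by [] | by rewrite !out_cat oE |].
rewrite !ev_cat ?oE ?eE //.
- by move: t; rewrite typed_cat => /andP[].
- by move: t'; rewrite typed_cat => /andP[].
Qed.

Lemma refines_catr w D E Q : refines w D E -> refines w (D ++ Q) (E ++ Q).
Proof. exact: (@refines_cat w [::]). Qed.

Lemma refines_catl w P D E : refines (out w P) D E ->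
  refines w (P ++ D) (P ++ E).
Proof. by move=> h; have := @refines_cat w P D E [::] h; rewrite !cats0. Qed.

(** A position counts the wires on the left, so the slice lying further right is renumbered by the
    change of width that the other one causes. The result is [None] when neither slice lies wholly
    beside the other. *)
Definition swap (s t : slice) : option (slice * slice) :=
  if t.1 + size (gdom t.2) <= s.1 then
    Some (t, (s.1 - size (gdom t.2) + size (gcod t.2), s.2))
  else if s.1 + size (gcod s.2) <= t.1 then
    Some ((t.1 - size (gcod s.2) + size (gdom s.2), t.2), s)
  else None.

Lemma slice_at w n l g r : w = l ++ gdom g ++ r -> n = size l ->
  [/\ fits w (n, g), step w (n, g) = l ++ gcod g ++ r
    & slice_sem w (n, g) = \id_(wsem l) ⊗ gsem g ⊗ \id_(wsem r)].
Proof. by move=> -> ->; split; rewrite ?fits_cat ?step_cat ?slice_sem_cat. Qed.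

(** Typing of both orders is part of the conclusion, so that both directions of the exchange follow
    from one computation. *)
Lemma swap_diamond w l g m h r n n' :
  w = l ++ gdom g ++ m ++ gdom h ++ r ->
  n = size (l ++ gcod g ++ m) -> n' = size (l ++ gdom g ++ m) ->
  let D := [:: (size l, g); (n, h)] in let E := [:: (n', h); (size l, g)] in
  [/\ typed w D, typed w E, out w D = out w E & ev w D = ev w E].
Proof.
move=> ew en en'.
have [f1 s1 v1] := slice_at ew (erefl (size l)).
have ew1 : l ++ gcod g ++ m ++ gdom h ++ r = (l ++ gcod g ++ m) ++ gdom h ++ r.
  by rewrite -!catA.
have [f2 s2 v2] := slice_at ew1 en.
have ew2 : w = (l ++ gdom g ++ m) ++ gdom h ++ r by rewrite -!catA.
have [f3 s3 v3] := slice_at ew2 en'.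
have ew3 : (l ++ gdom g ++ m) ++ gcod h ++ r = l ++ gdom g ++ m ++ gcod h ++ r.
  by rewrite -!catA.
have [f4 s4 v4] := slice_at ew3 (erefl (size l)).
have h1 := slice_sem_hom f1; have h2 := slice_sem_hom f2.
have h3 := slice_sem_hom f3; have h4 := slice_sem_hom f4.
rewrite v2 s2 in h2; rewrite v4 s4 in h4.
rewrite /= f1 f3 s1 s3 f2 f4 s2 s4 v1 v2 v3 v4 (comp_homl h2) (comp_homl h4).
rewrite -!catA; split=> //.
have hg := gsem_hom g; have hh := gsem_hom h.
have hm := hom_idm (wsem m).
have idE u v t : \id_(wsem (u ++ v ++ t)) =
    \id_(wsem u) ⊗ (\id_(wsem v) ⊗ \id_(wsem t)).
  by rewrite !mtens_idm !wsem_cat.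
rewrite !idE.
(* Taking [g] together with the middle wires as one morphism reduces the claim to interchange of two
   adjacent morphisms; the outer wires are tensored on afterwards. *)
have := tens_interchange (hom_tens hg hm) hh.
rewrite -!mtens_idm => core.
have hL := hom_tens (hom_tens hg hm) (hom_idm (wsem (gdom h))).
have hR := hom_tens (hom_idm (wsem (gcod g) ⊠ wsem m)) hh.
have hL' := hom_tens (hom_tens hg hm) (hom_idm (wsem (gcod h))).
have hR' := hom_tens (hom_idm (wsem (gdom g) ⊠ wsem m)) hh.
have hl := hom_idm (wsem l).
move/(congr1 (fun f => \id_(wsem l) ⊗ f ⊗ \id_(wsem r))): core.
rewrite -!mtens_idm in hR hR'.
rewrite (tens_id_comp _ hL hR) (tens_id_comp _ hR' hL').
rewrite (tens_comp_id _ (hom_tens hl hL) (hom_tens hl hR)).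
rewrite (tens_comp_id _ (hom_tens hl hR') (hom_tens hl hL')).
by rewrite !mtensA.
Qed.

Lemma swap_left w l g m h r n n' : w = l ++ gdom g ++ m ++ gdom h ++ r ->
  n = size (l ++ gcod g ++ m) -> n' = size (l ++ gdom g ++ m) ->
  refines w [:: (size l, g); (n, h)] [:: (n', h); (size l, g)].
Proof. by move=> ew en en' _; have [] := swap_diamond ew en en'. Qed.

Lemma swap_right w l g m h r n n' : w = l ++ gdom g ++ m ++ gdom h ++ r ->
  n = size (l ++ gcod g ++ m) -> n' = size (l ++ gdom g ++ m) ->
  refines w [:: (n', h); (size l, g)] [:: (size l, g); (n, h)].
Proof. by move=> ew en en' _; have [] := swap_diamond ew en en'. Qed.

Lemma swapP w s t s' t' : swap s t = Some (t', s') ->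
  refines w [:: s; t] [:: t'; s'].
Proof.
case: s t => [n g] [p h]; rewrite /swap /= => eswap ty.
suff: refines w [:: (n, g); (p, h)] [:: t'; s'] by apply.
case/and3P: ty => /fitsP[l [r /= [ew en]]]; rewrite ew en step_cat.
case/fitsP=> l1 [r1 /= [ew1 ep]] _; move: eswap.
case: leqP => [le1|_].
  (* Here the source of [h] lies among the wires left of [g]; [m] will be the wires between the
     two. *)
  have el : l = l1 ++ gdom h ++ drop (p + size (gdom h)) l.
    rewrite catA -{1}(cat_take_drop (p + size (gdom h)) l); congr (_ ++ _).
    rewrite -(@takel_cat _ _ l (gcod g ++ r)) -?en // ew1 ep -size_cat catA.
    exact: take_size_cat.
  set m := drop _ _ in el; rewrite el -!catA ep; case=> <- <-.
  apply: swap_right => //; rewrite en el !size_cat ?addnA //.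
  by rewrite (addnAC (size l1)) addnK addnAC.
case: leqP => // le2.
(* Now [h] lies to the right of the outputs of [g], so its source is a subword of [r]. *)
have er : r = drop (n + size (gcod g)) l1 ++ gdom h ++ r1.
  move: le2; rewrite en ep -size_cat => le2.
  have := congr1 (drop (size (l ++ gcod g))) ew1.
  rewrite catA drop_size_cat // drop_cat ltn_neqAle le2 andbT.
  by case: eqP => //= ->; rewrite subnn drop0 drop_oversize.
set m := drop _ _ in er.
have el1 : l1 = l ++ gcod g ++ m.
  rewrite catA -{1}(cat_take_drop (n + size (gcod g)) l1); congr (_ ++ _).
  rewrite -(@takel_cat _ _ l1 (gdom h ++ r1)) -?ep // -ew1 en -size_cat catA.
  exact: take_size_cat.
rewrite er en; case=> <- <-.
apply: swap_left => //; rewrite ep el1 !size_cat //.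
by rewrite addnCA addKn -addnA (addnC (size m)).
Qed.

Fixpoint bubble (L : seq slice) (s : slice) : option (slice * seq slice) :=
  if L is t :: L' then
    if bubble L' s is Some (s1, L1) then
      if swap t s1 is Some (s2, t2) then Some (s2, t2 :: L1) else None
    else None
  else Some (s, [::]).

Lemma bubbleP w L s s' L' : bubble L s = Some (s', L') ->
  refines w (rcons L s) (s' :: L').
Proof.
elim: L w s' L' => [|t L IH] w s' L' /=; first by move=> [-> <-].
case e: (bubble L s) => [[s1 L1]|//].
case e2: (swap t s1) => [[s2 t2]|//] [<- <-].
apply: (@refines_trans _ _ [:: t, s1 & L1]).
  by apply: (@refines_catl w [:: t]); apply: IH.
exact: (@refines_catr w [:: t; s1] [:: s2; t2]) (swapP e2).
Qed.

(** * Finding a pattern up to interchange *)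

Definition offset (pat sel : seq slice) : nat :=
  if pat is p :: _ then if sel is s :: _ then s.1 - p.1 else 0 else 0.

(** If the first selected slice lies too far left for the pattern, the truncated difference in
    [offset] is 0 and the comparison fails. *)
Definition matches (pat sel : seq slice) : bool :=
  sel == take (size sel) (shift (offset pat sel) pat).

(* An instance of [pat] need not be contiguous: [sel] collects its slices found
   so far, [post] the slices after it that depend on them.  A slice [s]
   following [sel ++ post] either joins the selection, or is moved before it
   if interchange allows. *)
Definition absorb pat sel post s : option (seq slice * seq slice * seq slice) :=
  if bubble post s is Some (s1, post1) then
    if matches pat (rcons sel s1) then Some ([::], rcons sel s1, post1)
    else if bubble sel s1 is Some (s2, sel2) then Some ([:: s2], sel2, post1)
    else None
  else None.

Lemma absorbP w pat sel post s pre' sel' post' :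
  absorb pat sel post s = Some (pre', sel', post') ->
  refines w (sel ++ rcons post s) (pre' ++ sel' ++ post').
Proof.
rewrite /absorb; case e: (bubble post s) => [[s1 post1]|//].
have h1 : refines w (sel ++ rcons post s) (rcons sel s1 ++ post1).
  by rewrite cat_rcons; apply: refines_catl (bubbleP e).
case: ifP => [_ [<- <- <-] //|_].
case e2: (bubble sel s1) => [[s2 sel2]|//] [<- <- <-].
exact: refines_trans h1 (refines_catr (bubbleP e2)).
Qed.

(** [absorb] also succeeds when it moves a slice out before the selection; the comparison of sizes
    tells whether the selection really grew. *)
Fixpoint extend (pat pre sel post rest : seq slice) :
    option (seq slice * seq slice * seq slice) :=
  if rest is s :: rest' then
    match absorb pat sel post s with
    | Some (pre1, sel1, post1) =>
        if size sel < size sel1 then Some (pre ++ pre1, sel1, post1 ++ rest')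
        else extend pat (pre ++ pre1) sel1 post1 rest'
    | None => extend pat pre sel (rcons post s) rest'
    end
  else None.

Lemma extendP w pat pre sel post rest pre' sel' rest' :
  extend pat pre sel post rest = Some (pre', sel', rest') ->
  refines w (pre ++ sel ++ post ++ rest) (pre' ++ sel' ++ rest').
Proof.
elim: rest pre sel post => //= s rest IH pre sel post.
rewrite -cat_rcons; case e: absorb => [[[pre1 sel1] post1]|]; last exact: IH.
have h : refines w (pre ++ sel ++ rcons post s ++ rest)
    ((pre ++ pre1) ++ sel1 ++ post1 ++ rest).
  rewrite -catA; apply: refines_catl; rewrite catA.
  have := @refines_catr (out w pre) _ _ rest (absorbP e).
  by rewrite -!catA; exact.
by case: ifP => [_ [<- <- <-] //|_ /IH]; apply: refines_trans h.
Qed.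

Fixpoint gather k (pat pre sel rest : seq slice) :
    option (seq slice * seq slice * seq slice) :=
  if k is k'.+1 then
    if extend pat pre sel [::] rest is Some (pre1, sel1, rest1)
    then gather k' pat pre1 sel1 rest1 else None
  else Some (pre, sel, rest).

Lemma gatherP w k pat pre sel rest pre' sel' rest' :
  gather k pat pre sel rest = Some (pre', sel', rest') ->
  refines w (pre ++ sel ++ rest) (pre' ++ sel' ++ rest').
Proof.
elim: k pre sel rest => [|k IH] pre sel rest /=; first by move=> [<- <- <-].
case e: extend => [[[pre1 sel1] rest1]|//] /IH.
by apply: refines_trans; apply: extendP e.
Qed.

(** * Rewriting rules and normal forms *)

Record rule := Rule { rwires : seq nat; rlhs : seq slice; rrhs : seq slice }.

Definition sound (r : rule) : Prop := [/\ typed (rwires r) (rlhs r),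
  typed (rwires r) (rrhs r), out (rwires r) (rrhs r) = out (rwires r) (rlhs r)
  & ev (rwires r) (rrhs r) = ev (rwires r) (rlhs r)].

(** [gatherP] only guarantees that the slices were legitimately reordered. That the selection is an
    instance of the left side, on the right wires, is tested here, so nothing else has to be proved
    about the search. The wires are compared separately because a rule may have strands that its
    left side does not touch. *)
Definition rewrite_here w pre rest (r : rule) : option (seq slice) :=
  if gather (size (rlhs r)) (rlhs r) pre [::] rest is Some (pre', sel, post)
  then
    let n := offset (rlhs r) sel in
    let u := out w pre' in
    if [&& sel == shift n (rlhs r), n <= size u &
           take (size (rwires r)) (drop n u) == rwires r]
    then Some (pre' ++ shift n (rrhs r) ++ post) else None
  else None.

Lemma rewrite_hereP w pre rest r D : sound r ->
  rewrite_here w pre rest r = Some D -> refines w (pre ++ rest) D.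
Proof.
case=> tl tr eo ee; rewrite /rewrite_here.
case e: gather => [[[pre' sel] post]|//]; move: (offset _ sel) => n.
case: and3P => // -[/eqP es le_n /eqP eu] [<-].
apply: refines_trans (gatherP e) _; rewrite {}es; apply: refines_cat => _.
set u := out w pre' in le_n eu *.
have [l [r' [-> ->]]] : exists l r', u = l ++ rwires r ++ r' /\ n = size l.
  exists (take n u), (drop (size (rwires r)) (drop n u)).
  by rewrite -{1}eu !cat_take_drop size_takel.
have [hl1 hl2 hl3] := whisker l r' tl; have [hr1 hr2 hr3] := whisker l r' tr.
by rewrite hl2 hl3 hr2 hr3 eo ee.
Qed.

Fixpoint rewrite_one (r : rule) w (pre rest : seq slice) :
    option (seq slice) :=
  if rest is s :: rest' then
    if (if ohead (rlhs r) is Some p then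
          if p.2 == s.2 then rewrite_here w pre rest r else None
        else None) is Some D
    then Some D else rewrite_one r w (rcons pre s) rest'
  else None.

Lemma rewrite_oneP r w pre rest D : sound r ->
  rewrite_one r w pre rest = Some D -> refines w (pre ++ rest) D.
Proof.
move=> hr; elim: rest pre => [//|s rest IH] pre /=.
case: ohead => [p|]; last by rewrite -cat_rcons; apply: IH.
case: eqP => _; last by rewrite -cat_rcons; apply: IH.
case e: rewrite_here => [D'|]; last by rewrite -cat_rcons; apply: IH.
by case=> <-; apply: rewrite_hereP e.
Qed.

Fixpoint rewrite_first (rs : seq rule) w (D : seq slice) : option (seq slice) :=
  if rs is r :: rs' then
    if rewrite_one r w [::] D is Some E then Some E else rewrite_first rs' w D
  else None.

Fixpoint all_sound rs : Prop :=
  if rs is r :: rs' then sound r /\ all_sound rs' else True.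

Lemma rewrite_firstP rs w D E : all_sound rs ->
  rewrite_first rs w D = Some E -> refines w D E.
Proof.
elim: rs => //= r rs IH [hr hrs]; case e: rewrite_one => [E'|]; last exact: IH.
by case=> <-; apply: rewrite_oneP e.
Qed.

(** Fuel replaces a termination proof; a diagram reached when it runs out is still a correct
    refinement. *)
Fixpoint normalize fuel rs w (D : seq slice) : seq slice :=
  if fuel is k.+1 then
    if rewrite_first rs w D is Some D' then normalize k rs w D' else D
  else D.

Lemma normalizeP fuel rs w D : all_sound rs ->
  refines w D (normalize fuel rs w D).
Proof.
move=> hrs; elim: fuel D => //= k IH D.
case e: rewrite_first => [D'|//].
exact: refines_trans (rewrite_firstP hrs e) (IH D').
Qed.

Fixpoint pull (s : slice) (L D : seq slice) : option (seq slice) :=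
  if D is t :: D' then
    if (if bubble L t is Some (t', L') then
          if t' == s then Some (L' ++ D') else None else None) is Some E
    then Some E else pull s (rcons L t) D'
  else None.

Lemma pullP w s L D E : pull s L D = Some E -> refines w (L ++ D) (s :: E).
Proof.
elim: D L => //= t D IH L; rewrite -cat_rcons.
case e: bubble => [[t' L']|]; last exact: IH.
case: eqP => [<- [<-]|_]; last exact: IH.
exact: (refines_catr (bubbleP e)).
Qed.

(** Normal forms are compared only up to interchange: each slice of [D] in turn is pulled to the
    front of what remains of [E]. *)
Fixpoint agree (D E : seq slice) : bool :=
  if D is s :: D' then if pull s [::] E is Some E' then agree D' E' else false
  else nilp E.

Lemma agreeP w D E : agree D E -> refines w E D.
Proof.
elim: D w E => [|s D IH] w E /=; first by move=> /nilP ->.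
case e: pull => [E'|//] /(IH (step w s)) h.
apply: refines_trans (pullP e) _.
exact: (@refines_catl w [:: s]).
Qed.

(** * Syntax of objects and morphisms *)

Inductive oterm := OUnit | OAtom of nat | OTens of oterm & oterm.

(** Brackets and units are kept as written: strictness is a propositional equality, so a word would
    not be convertible to the object in the goal. *)
Fixpoint osem o : ob K :=
  match o with
  | OUnit => ounit K | OAtom a => atom a | OTens o1 o2 => osem o1 ⊠ osem o2
  end.
Fixpoint wires o : seq nat :=
  match o with
  | OUnit => [::] | OAtom a => [:: a] | OTens o1 o2 => wires o1 ++ wires o2
  end.

Lemma wsem_wires o : wsem (wires o) = osem o.
Proof. by elim: o => //= [a|o1 <- o2 <-]; rewrite ?otensX1 ?wsem_cat. Qed.

Definition oword : seq nat -> oterm := foldr (fun a => OTens (OAtom a)) OUnit.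

Lemma wires_oword w : wires (oword w) = w.
Proof. by elim: w => //= a w ->. Qed.

Inductive term := TId of oterm | TBraid of oterm & oterm | TBox of nat
  | TComp of term & term | TTens of term & term.

Fixpoint tsem t : mor K :=
  match t with
  | TId o => \id_(osem o)
  | TBraid o1 o2 => \Psi_(osem o1, osem o2)
  | TBox n => (box n).1
  | TComp t1 t2 => tsem t1 ∘ tsem t2
  | TTens t1 t2 => tsem t1 ⊗ tsem t2
  end.

Fixpoint tdom t : seq nat :=
  match t with
  | TId o => wires o
  | TBraid o1 o2 => wires o1 ++ wires o2
  | TBox n => (box n).2.1
  | TComp _ t2 => tdom t2
  | TTens t1 t2 => tdom t1 ++ tdom t2
  end.

Fixpoint tcod t : seq nat :=
  match t with
  | TId o => wires o
  | TBraid o1 o2 => wires o2 ++ wires o1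
  | TBox n => (box n).2.2
  | TComp t1 _ => tcod t1
  | TTens t1 t2 => tcod t1 ++ tcod t2
  end.

Fixpoint tok t : bool :=
  match t with
  | TComp t1 t2 => [&& tok t1, tok t2 & tdom t1 == tcod t2]
  | TTens t1 t2 => tok t1 && tok t2
  | _ => true
  end.

(** One strand past a word, unfolding [braid_tensr]; [cross] then unfolds [braid_tensl] in the other
    argument. *)
Fixpoint cross1 (a : nat) (v : seq nat) : seq slice :=
  if v is b :: v' then (0, inr (a, b)) :: shift 1 (cross1 a v') else [::].

Fixpoint cross (u v : seq nat) : seq slice :=
  if u is a :: u' then shift 1 (cross u' v) ++ cross1 a v else [::].

(** In a tensor product the left factor is performed first, so the right one is shifted by the width
    of the target of the left one. *)
Fixpoint flat t : seq slice :=
  match t with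
  | TId _ => [::]
  | TBraid o1 o2 => cross (wires o1) (wires o2)
  | TBox n => [:: (0, inl n)]
  | TComp t1 t2 => flat t2 ++ flat t1
  | TTens t1 t2 => flat t1 ++ shift (size (tcod t1)) (flat t2)
  end.

Definition denotes w D v f := [/\ typed w D, out w D = v & ev w D = f].

Lemma denotes_hom w D v f : denotes w D v f -> f ∷ wsem w ⟶ wsem v.
Proof. by case=> /ev_hom h <- <-. Qed.

Lemma denotes_cat u v w D E f g : denotes u D v f -> denotes v E w g ->
  denotes u (D ++ E) w (g ∘ f).
Proof.
case=> tD oD eD [tE oE eE].
have t : typed u (D ++ E) by rewrite typed_cat tD oD.
by split; rewrite ?out_cat ?ev_cat ?oD ?eD ?eE.
Qed.

Lemma denotes_whisker l w r D v f : denotes w D v f ->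
  denotes (l ++ w ++ r) (shift (size l) D) (l ++ v ++ r)
    (\id_(wsem l) ⊗ f ⊗ \id_(wsem r)).
Proof. by case=> tD <- <-; exact: whisker. Qed.

Lemma denotes_box n : denotes (box n).2.1 [:: (0, inl n)] (box n).2.2 (box n).1.
Proof.
have := @slice_at ((box n).2.1) 0 [::] (inl n) [::].
rewrite /= !cats0 => /(_ erefl erefl)[h1 h2 h3].
split; rewrite /= ?h1 ?h2 ?h3 // mtens1f mtensf1.
exact: comp_homl (boxesP n).
Qed.

Lemma denotes_cross1 a v :
  denotes (a :: v) (cross1 a v) (rcons v a) \Psi_(atom a, wsem v).
Proof.
elim: v => [|b v IH] /=.
  by split=> //=; rewrite braid_unitr otensX1.
have h := denotes_whisker [:: b] [::] IH.
rewrite /= !cats0 !otensX1 mtensf1 in h.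
rewrite braid_tensr.
apply: (@denotes_cat _ (b :: a :: v) _ [:: (0, inr (a, b))]) h.
have := @slice_at [:: a, b & v] 0 [::] (inr (a, b)) v erefl erefl.
case=> h1 h2 h3; split; rewrite /= ?h1 ?h2 ?h3 // mtens1f.
apply: (@comp_homl _ (wsem [:: a, b & v])); rewrite /= drop0 !otensA.
exact: hom_tens (hom_braid _ _) (hom_idm _).
Qed.

Lemma denotes_cross u v :
  denotes (u ++ v) (cross u v) (v ++ u) \Psi_(wsem u, wsem v).
Proof.
elim: u => [|a u IH] /=.
  by split=> //=; rewrite ?cats0 // braid_unitl.
have h := denotes_whisker [:: a] [::] IH.
rewrite /= !cats0 !otensX1 mtensf1 in h.
rewrite braid_tensl; apply: denotes_cat h _.
have := denotes_whisker [::] u (denotes_cross1 a v).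
by rewrite /= mtens1f cat_rcons /shift map_id_in //; case.
Qed.

Lemma denotes_flat t : tok t -> denotes (tdom t) (flat t) (tcod t) (tsem t).
Proof.
elim: t => [o|o1 o2|n|t1 IH1 t2 IH2|t1 IH1 t2 IH2] /=.
- by move=> _; split; rewrite /= ?wsem_wires.
- by move=> _; rewrite -!wsem_wires; apply: denotes_cross.
- by move=> _; apply: denotes_box.
- case/and3P=> /IH1 h1 /IH2 h2 /eqP e.
  by apply: denotes_cat h2 _; rewrite -e.
- case/andP=> /IH1 h1 /IH2 h2.
  rewrite (tens_sep (denotes_hom h1) (denotes_hom h2)).
  have := denotes_whisker [::] (tdom t2) h1.
  have := denotes_whisker (tcod t1) [::] h2.
  rewrite /= !cats0 mtens1f mtensf1 => h2' h1'.
  apply: denotes_cat h2'; move: h1'.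
  by rewrite /shift map_id_in //; case.
Qed.

(** Carries the equation only; that both sides are well typed and parallel is left to computation in
    [decide]. *)
Record law := Law { llhs : term; lrhs : term; lawP : tsem llhs = tsem lrhs }.

Definition parallel t1 t2 : bool :=
  [&& tok t1, tok t2, tdom t1 == tdom t2 & tcod t1 == tcod t2].

Definition rule_of (e : law) : rule :=
  Rule (tdom (llhs e)) (flat (llhs e)) (flat (lrhs e)).

Lemma sound_law e : parallel (llhs e) (lrhs e) -> sound (rule_of e).
Proof.
case: e => t1 t2 e /= /and4P[/denotes_flat[h1 h2 h3] /denotes_flat[h4 h5 h6]].
by move=> /eqP ed /eqP ec; split; rewrite /= ?h1 ?h2 ?h3 ?ed //; congruence.
Qed.

(* Laws are used from left to right, and earlier laws take priority. *)
Definition decide fuel (laws : seq law) t1 t2 : bool :=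
  let rs := [seq rule_of e | e <- laws] in
  let w := tdom t1 in
  [&& all (fun e => parallel (llhs e) (lrhs e)) laws, parallel t1 t2 &
      agree (normalize fuel rs w (flat t1)) (normalize fuel rs w (flat t2))].

(** Normalization preserves the value of each side, and the two normal forms differ by interchanges.
    Only soundness is claimed: a negative answer proves nothing. *)
Lemma decideP fuel laws t1 t2 : decide fuel laws t1 t2 -> tsem t1 = tsem t2.
Proof.
case/and3P=> hl /and4P[/denotes_flat[h1 _ h3] /denotes_flat[h4 _ h6] /eqP ed _].
have hs : all_sound [seq rule_of e | e <- laws].
  elim: laws hl => //= e laws IH /andP[he /IH]; split=> //; exact: sound_law.
move=> /(agreeP (w := tdom t1)) h.
have [tn1 _ en1] := normalizeP fuel hs h1.
rewrite -ed in h4 h6.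
have [tn2 _ en2] := normalizeP fuel hs h4.
have [_ _ e12] := h tn2.
by rewrite -h3 -h6 -en1 -en2 e12.
Qed.

(** Naturality of the braiding, oriented so that the box moves from after the crossing to before it;
    [esym] gives the opposite move. *)
Lemma passl_holds n a : let o := OAtom a in
  tsem (TComp (TTens (TId o) (TBox n)) (TBraid (oword (box n).2.1) o)) =
  tsem (TComp (TBraid (oword (box n).2.2) o) (TTens (TBox n) (TId o))).
Proof.
rewrite /= -!wsem_wires !wires_oword; symmetry.
exact: braid_natl (boxesP n).
Qed.

Lemma passr_holds n a : let o := OAtom a in
  tsem (TComp (TTens (TBox n) (TId o)) (TBraid o (oword (box n).2.1))) =
  tsem (TComp (TBraid o (oword (box n).2.2)) (TTens (TId o) (TBox n))).
Proof.
rewrite /= -!wsem_wires !wires_oword; symmetry.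
exact: braid_natr (boxesP n).
Qed.

(* [ups] move towards the source of a diagram, [downs] towards its target. *)
Definition braid_laws (ups downs : seq nat) : seq law :=
  let atoms := iota 0 (size obs) in
  [seq Law (passl_holds n a) | n <- ups, a <- atoms] ++
  [seq Law (passr_holds n a) | n <- ups, a <- atoms] ++
  [seq Law (esym (passl_holds n a)) | n <- downs, a <- atoms] ++
  [seq Law (esym (passr_holds n a)) | n <- downs, a <- atoms].

End Diagrams.

(** * Reification of objects and morphisms *)

Ltac index_in x l :=
  lazymatch l with
  | x :: _ => constr:(0)
  | (x, _) :: _ => constr:(0)
  | _ :: ?l' => let n := index_in x l' in constr:(S n)
  end.

Ltac reify_ob obs X :=
  lazymatch X with
  | ounit _ => constr:(OUnit)
  | ?Y ⊠ ?Z => let o1 := reify_ob obs Y in let o2 := reify_ob obs Z in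
      constr:(OTens o1 o2)
  | _ => let n := index_in X obs in constr:(OAtom n)
  end.

Ltac reify obs boxes f :=
  lazymatch f with
  | \id_ ?X => let o := reify_ob obs X in constr:(TId o)
  | \Psi_(?X, ?Y) => let o1 := reify_ob obs X in let o2 := reify_ob obs Y in
      constr:(TBraid o1 o2)
  | ?g ∘ ?h => let t1 := reify obs boxes g in let t2 := reify obs boxes h in
      constr:(TComp t1 t2)
  | ?g ⊗ ?h => let t1 := reify obs boxes g in let t2 := reify obs boxes h in
      constr:(TTens t1 t2)
  | _ => let n := index_in f boxes in constr:(TBox n)
  end.

(** * The twisted multiplication *)

Section Twist.
Variables (K : strictBraidedCat) (H : bialgData K).
Hypothesis hH : is_bialgebra \Psi_(H, H) H.
Variables (B : bialgData K) (muB nuB : mor K).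
Hypothesis hB : is_right_crossed_bialgebra H B muB nuB.
Variables (C : bialgData K) (muC nuC : mor K).
Hypothesis hC : is_left_crossed_bialgebra H C muC nuC.
Variables (rho rhoV : mor K).
Hypothesis hrho : is_conv_inverse (tens_coalg B C) rho rhoV.

(** The atoms 0, 1, 2 in the types of [morphisms] are $C$, $H$, $B$. *)
Definition objects : seq (ob K) := [:: cobj C; cobj H; cobj B].

Definition morphisms : seq (mor K * (seq nat * seq nat)) :=
  [:: (\m_C, ([:: 0; 0], [:: 0])); (\Delta_C, ([:: 0], [:: 0; 0]));
      (\eps_C, ([:: 0], [::])); (muC, ([:: 1; 0], [:: 0]));
      (nuC, ([:: 0], [:: 1; 0]));
      (\m_H, ([:: 1; 1], [:: 1])); (\eta_H, ([::], [:: 1]));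
      (\Delta_H, ([:: 1], [:: 1; 1])); (\eps_H, ([:: 1], [::]));
      (\m_B, ([:: 2; 2], [:: 2])); (\Delta_B, ([:: 2], [:: 2; 2]));
      (\eps_B, ([:: 2], [::])); (muB, ([:: 2; 1], [:: 2]));
      (nuB, ([:: 2], [:: 2; 1]));
      (rho, ([:: 2; 0], [::])); (rhoV, ([:: 2; 0], [::]))].

Lemma morphisms_typed : boxes_typed objects morphisms.
Proof.
case: hH => [[mH uH _ _ _] [dH eH _ _ _] _].
case: hB => -[[muBt _ _] [nuBt _ _] _] _ [[mB _ _ _ _] [dB eB _ _ _] _].
case: hC => -[[muCt _ _] [nuCt _ _] _] _ [[mC _ _ _ _] [dC eC _ _ _] _].
case: hrho => rt rVt _ _.
(* One case for each listed morphism; larger indices reach the default box. *)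
do 16?[case; first by rewrite /box /wsem /= !otensX1].
by move=> n; rewrite /box nth_default //=; apply: hom_idm.
Qed.

Ltac reify_here f :=
  let obs := eval unfold objects in objects in
  let boxes := eval unfold morphisms in morphisms in
  reify obs boxes f.

Ltac law h :=
  lazymatch type of h with ?f = ?g =>
    let t1 := reify_here f in let t2 := reify_here g in
    exact (@Law K objects morphisms t1 t2 h)
  end.

Ltac diagram laws :=
  lazymatch goal with |- ?f = ?g =>
    let t1 := reify_here f in let t2 := reify_here g in
    apply: (@decideP K objects morphisms morphisms_typed 300 laws t1 t2);
    by vm_compute
  end.

(** With this list [diagram] uses strictness, interchange and the hexagons alone. *)
Definition no_laws : seq (law objects morphisms) := [::].

(** * Axioms that serve as rewriting laws *)

Lemma assocH : \m_H ∘ (\m_H ⊗ \id_H) = \m_H ∘ (\id_H ⊗ \m_H).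
Proof. by case: hH => -[]. Qed.

Lemma unitlH : \m_H ∘ (\eta_H ⊗ \id_H) = \id_H.
Proof. by case: hH => -[]. Qed.

Lemma unitrH : \m_H ∘ (\id_H ⊗ \eta_H) = \id_H.
Proof. by case: hH => -[]. Qed.

Lemma counitlH : (\eps_H ⊗ \id_H) ∘ \Delta_H = \id_H.
Proof. by case: hH => _ []. Qed.

Lemma counitrH : (\id_H ⊗ \eps_H) ∘ \Delta_H = \id_H.
Proof. by case: hH => _ []. Qed.

Lemma comul_mulH : \Delta_H ∘ \m_H =
  (\m_H ⊗ \m_H) ∘ (\id_H ⊗ \Psi_(H, H) ⊗ \id_H) ∘ (\Delta_H ⊗ \Delta_H).
Proof. by case: hH => _ _ []. Qed.

Lemma counit_mulH : \eps_H ∘ \m_H = \eps_H ⊗ \eps_H.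
Proof. by case: hH => _ _ []. Qed.

Lemma coassocB : (\Delta_B ⊗ \id_B) ∘ \Delta_B = (\id_B ⊗ \Delta_B) ∘ \Delta_B.
Proof. by case: hB => _ _ [_ []]. Qed.

Lemma counitlB : (\eps_B ⊗ \id_B) ∘ \Delta_B = \id_B.
Proof. by case: hB => _ _ [_ []]. Qed.

Lemma counitrB : (\id_B ⊗ \eps_B) ∘ \Delta_B = \id_B.
Proof. by case: hB => _ _ [_ []]. Qed.

Lemma counitlC : (\eps_C ⊗ \id_C) ∘ \Delta_C = \id_C.
Proof. by case: hC => _ _ [_ []]. Qed.

Lemma counitrC : (\id_C ⊗ \eps_C) ∘ \Delta_C = \id_C.
Proof. by case: hC => _ _ [_ []]. Qed.

Lemma act_mulB : muB ∘ (muB ⊗ \id_H) = muB ∘ (\id_B ⊗ \m_H).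
Proof. by case: hB => -[[]]. Qed.

Lemma act_mulC : muC ∘ (\id_H ⊗ muC) = muC ∘ (\m_H ⊗ \id_C).
Proof. by case: hC => -[[]]. Qed.

Lemma coact_counitB : (\id_B ⊗ \eps_H) ∘ nuB = \id_B.
Proof. by case: hB => -[_ []]. Qed.

Lemma coact_counitC : (\eps_H ⊗ \id_C) ∘ nuC = \id_C.
Proof. by case: hC => -[_ []]. Qed.

(** The counit of $B$ is a comodule map to the unit object, whose coaction is [\eta_H]. *)
Lemma counit_coactB : (\eps_B ⊗ \id_H) ∘ nuB = \eta_H ∘ \eps_B.
Proof. by case: hB => _ [_ _ _ [_ _ ->]]. Qed.

Lemma counit_coactC : (\id_H ⊗ \eps_C) ∘ nuC = \eta_H ∘ \eps_C.
Proof. by case: hC => _ [_ _ _ [_ _ ->]]. Qed.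

Lemma conv_rho_rhoV : (rho ⊗ rhoV)
  ∘ ((\id_B ⊗ \Psi_(B, C) ⊗ \id_C) ∘ (\Delta_B ⊗ \Delta_C)) = \eps_B ⊗ \eps_C.
Proof. by case: hrho. Qed.

Lemma conv_rhoV_rho : (rhoV ⊗ rho)
  ∘ ((\id_B ⊗ \Psi_(B, C) ⊗ \id_C) ∘ (\Delta_B ⊗ \Delta_C)) = \eps_B ⊗ \eps_C.
Proof. by case: hrho. Qed.

(* The boxes moved towards the source are the comultiplications, counits and
   coactions, and rho and rhoV; the units, products and actions are moved
   towards the target. *)
Definition counit_laws : seq (law objects morphisms) :=
  [:: ltac:(law counit_mulH); ltac:(law counitlH); ltac:(law counitrH);
      ltac:(law counitlB); ltac:(law counitrB);
      ltac:(law counitlC); ltac:(law counitrC);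
      ltac:(law coact_counitB); ltac:(law coact_counitC);
      ltac:(law counit_coactB); ltac:(law counit_coactC);
      ltac:(law unitlH); ltac:(law unitrH)]
  ++ braid_laws morphisms_typed
       [:: 1; 2; 4; 7; 8; 10; 11; 13; 14; 15] [:: 0; 3; 5; 6; 9; 12].

Definition inverse_laws : seq (law objects morphisms) :=
  [:: ltac:(law conv_rho_rhoV); ltac:(law conv_rhoV_rho)] ++ counit_laws.

(* [counit_laws] comes first so that rho and rhoV are moved away from the
   strands of H before [comul_mulH] multiplies the crossings. *)
Definition product_laws : seq (law objects morphisms) :=
  counit_laws
  ++ [:: ltac:(law coassocB); ltac:(law assocH); ltac:(law comul_mulH);
         ltac:(law act_mulB); ltac:(law act_mulC)].

(** * Twisting $Z$ by $\hat\rho$ *)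

Let Z := cross_bialg H C muC nuC B muB nuB.
Let ZZ := tens_coalg Z Z.

Lemma hat_hom chi : chi ∷ B ⊠ C ⟶ ounit K -> hat C H B chi ∷ ZZ ⟶ ounit K.
Proof.
move=> hchi; case: hH => _ [_ eH _ _ _] _.
case: hB => _ _ [_ [_ eB _ _ _] _]; case: hC => _ _ [_ [_ eC _ _ _] _].
have := hom_tens (hom_tens (hom_tens eC eH) hchi) (hom_tens eH eB).
by rewrite /ZZ /Z /= !otens1X !otensA.
Qed.

(** The counits in both factors remove the coactions and the part of the comultiplication on $H$;
    what remains is the convolution of [rho] and [rhoV] on $B\otimes C$. *)
Lemma hat_conv_inverse :
  is_conv_inverse ZZ (hat C H B rho) (hat C H B rhoV).
Proof.
case: hrho => hr hrV _ _; split; try exact: hat_hom.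
- by rewrite /conv /hat /ZZ /Z /=; diagram inverse_laws.
- by rewrite /conv /hat /ZZ /Z /=; diagram inverse_laws.
Qed.

(** The $H$-leg of [nuB] on $b_{(1)}$ goes to the second copy of $Z$, where no counit meets it, and
    survives as a factor of $h$. On $b'$ the counit turns [nuB] into [\eta_H], which the unit law
    absorbs. *)
Lemma hat_rho_comul : (hat C H B rho ⊗ \id_ZZ) ∘ \Delta_ZZ =
  (\id_C ⊗ \m_H ⊗ \id_(B ⊠ Z)) ∘ (\id_(C ⊠ H) ⊗ rho ⊗ \id_(H ⊠ B ⊠ Z))
  ∘ (\id_(C ⊠ H ⊠ B) ⊗ \Psi_(H ⊠ B, C) ⊗ \id_Z)
  ∘ (\id_(C ⊠ H) ⊗ nuB ⊗ \id_B ⊗ \Delta_C ⊗ \id_(H ⊠ B))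
  ∘ (\id_(C ⊠ H) ⊗ \Delta_B ⊗ \id_Z).
Proof. by rewrite /hat /ZZ /Z /=; diagram counit_laws. Qed.

(** Mirror image: the $H$-leg of [nuC] on $c'_{(2)}$ stays in the first copy of $Z$ and multiplies
    $h'$ from the left. *)
Lemma hat_rhoV_comul : (\id_ZZ ⊗ hat C H B rhoV) ∘ \Delta_ZZ =
  (\id_(Z ⊠ C) ⊗ \m_H ⊗ \id_B) ∘ (\id_(Z ⊠ C ⊠ H) ⊗ rhoV ⊗ \id_(H ⊠ B))
  ∘ (\id_Z ⊗ \Psi_(B, C ⊠ H) ⊗ \id_(C ⊠ H ⊠ B))
  ∘ (\id_(C ⊠ H) ⊗ \Delta_B ⊗ \id_C ⊗ nuC ⊗ \id_(H ⊠ B))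
  ∘ (\id_Z ⊗ \Delta_C ⊗ \id_(H ⊠ B)).
Proof. by rewrite /hat /ZZ /Z /=; diagram counit_laws. Qed.

(** The bracketing in [twist] makes $\hat\rho^-$ the outer convolution factor, so it is the first to
    act on the input; functoriality of the tensor product then separates the three stages. *)
Lemma twist_mulE : bmul (twist Z (hat C H B rho) (hat C H B rhoV)) =
  \m_Z ∘ ((hat C H B rho ⊗ \id_ZZ) ∘ \Delta_ZZ)
    ∘ ((\id_ZZ ⊗ hat C H B rhoV) ∘ \Delta_ZZ).
Proof. by rewrite /twist /conv /hat /ZZ /Z /=; diagram no_laws. Qed.

Lemma twist_mul_formula : bmul (twist Z (hat C H B rho) (hat C H B rhoV)) =
    (\m_C ⊗ \m_H ⊗ \m_B)
    ∘ (\id_C ⊗ muC ⊗ \m_H ⊗ \id_H ⊗ muB ⊗ \id_B)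
    ∘ (\id_C ⊗ \id_H ⊗ \Psi_(H, C) ⊗ \id_H ⊗ \Psi_(B, H) ⊗ \id_H ⊗ \id_B)
    ∘ (\id_(C ⊠ H ⊠ H) ⊗ muC ⊗ \m_H ⊗ muB ⊗ \id_(H ⊠ H ⊠ B))
    ∘ (\id_(C ⊠ H ⊠ H) ⊗ \id_H ⊗ \Psi_(H, C) ⊗ \Psi_(B, H) ⊗ \id_H
       ⊗ \id_(H ⊠ H ⊠ B))
    ∘ (\id_(C ⊠ H ⊠ H) ⊗ rho ⊗ \Delta_H ⊗ \id_C ⊗ \id_B ⊗ \Delta_H ⊗ rhoV
       ⊗ \id_(H ⊠ H ⊠ B))
    ∘ (\id_(C ⊠ H ⊠ H) ⊗ \id_B ⊗ \Psi_(H, C) ⊗ \id_C ⊗ \id_B ⊗ \Psi_(B, H)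
       ⊗ \id_C ⊗ \id_(H ⊠ H ⊠ B))
    ∘ (\id_(C ⊠ H ⊠ H) ⊗ nuB ⊗ \Delta_C ⊗ \Delta_B ⊗ nuC ⊗ \id_(H ⊠ H ⊠ B))
    ∘ (\id_(C ⊠ H ⊠ H) ⊗ \id_B ⊗ \Psi_(B, C) ⊗ \id_C ⊗ \id_(H ⊠ H ⊠ B))
    ∘ (\id_C ⊗ \Delta_H ⊗ \Delta_B ⊗ \Delta_C ⊗ \Delta_H ⊗ \id_B).
Proof.
by rewrite twist_mulE hat_rho_comul hat_rhoV_comul /=; diagram product_laws.
Qed.

End Twist.

Theorem corollary3p5 (K : strictBraidedCat) (hK : idempotents_split K)
  (H : bialgData K) (S : mor K) (hH : is_hopf_algebra H S) (hS : is_iso S)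
  (B : bialgData K) (muB nuB : mor K)
  (hB : is_right_crossed_bialgebra H B muB nuB)
  (C : bialgData K) (muC nuC : mor K)
  (hC : is_left_crossed_bialgebra H C muC nuC)
  (hBC : \Psi_(C, B) ∘ \Psi_(B, C)
         = (muB ⊗ muC) ∘ (\id_B ⊗ \Psi_(H, H) ⊗ \id_C) ∘ (nuB ⊗ nuC))
  (rho rhoV : mor K)
  (hrho : is_conv_inverse (tens_coalg B C) rho rhoV)
  (rho_act : rho ∘ (muB ⊗ \id_C) = rho ∘ (\id_B ⊗ muC))
  (rho_mulC : rho ∘ (\id_B ⊗ \m_C)
     = pairing2 B C rho ∘ ((\PsiV_(B, B) ∘ \Delta_B) ⊗ \id_(C ⊠ C)))
  (rho_mulB : rho ∘ (\m_B ⊗ \id_C)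
     = pairing2 B C rho
       ∘ (right_crossed_braid H (CrossedData B muB nuB) (CrossedData B muB nuB)
          ⊗ (\PsiV_(C, C) ∘ \Delta_C))) :
  let Z := cross_bialg H C muC nuC B muB nuB in
  let rho_hat := hat C H B rho in
  let rho_hatV := hat C H B rhoV in
  is_conv_inverse (tens_coalg Z Z) rho_hat rho_hatV /\
  bmul (twist Z rho_hat rho_hatV) =
    (\m_C ⊗ \m_H ⊗ \m_B)
    ∘ (\id_C ⊗ muC ⊗ \m_H ⊗ \id_H ⊗ muB ⊗ \id_B)
    ∘ (\id_C ⊗ \id_H ⊗ \Psi_(H, C) ⊗ \id_H ⊗ \Psi_(B, H) ⊗ \id_H ⊗ \id_B)
    ∘ (\id_(C ⊠ H ⊠ H) ⊗ muC ⊗ \m_H ⊗ muB ⊗ \id_(H ⊠ H ⊠ B))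
    ∘ (\id_(C ⊠ H ⊠ H) ⊗ \id_H ⊗ \Psi_(H, C) ⊗ \Psi_(B, H) ⊗ \id_H
       ⊗ \id_(H ⊠ H ⊠ B))
    ∘ (\id_(C ⊠ H ⊠ H) ⊗ rho ⊗ \Delta_H ⊗ \id_C ⊗ \id_B ⊗ \Delta_H ⊗ rhoV
       ⊗ \id_(H ⊠ H ⊠ B))
    ∘ (\id_(C ⊠ H ⊠ H) ⊗ \id_B ⊗ \Psi_(H, C) ⊗ \id_C ⊗ \id_B ⊗ \Psi_(B, H)
       ⊗ \id_C ⊗ \id_(H ⊠ H ⊠ B))
    ∘ (\id_(C ⊠ H ⊠ H) ⊗ nuB ⊗ \Delta_C ⊗ \Delta_B ⊗ nuC ⊗ \id_(H ⊠ H ⊠ B))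
    ∘ (\id_(C ⊠ H ⊠ H) ⊗ \id_B ⊗ \Psi_(B, C) ⊗ \id_C ⊗ \id_(H ⊠ H ⊠ B))
    ∘ (\id_C ⊗ \Delta_H ⊗ \Delta_B ⊗ \Delta_C ⊗ \Delta_H ⊗ \id_B).
Proof.
case: hH => bH _ _ _.
exact (conj (hat_conv_inverse bH hB hC hrho)
            (twist_mul_formula bH hB hC hrho)).
Qed.
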